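(* Let $d\ge2$ and let $P$ be a $d$-SMP. Then $P$ has no more than one occurrence in any $d$-dimensional permutation (of any length $n$) if and only if there is a minus-antipodal $d$-SMP $P'$ such that $P'\subseteq P$.
   Context: A $d$-dimensional permutation $\Pi$ of length $n\ge 1$ is an ordered $(d-1)$-tuple $(\pi^2,\dots,\pi^d)$ of permutations of $\{1,\dots,n\}$, with $\pi^i=\pi^i_1\cdots\pi^i_n$; set $\pi^1=12\cdots n$. Its elements are the $d$-tuples $\Pi_j=(\pi^1_j,\pi^2_j,\dots,\pi^d_j)^T$, $1\le j\le n$. A $d$-dimensional singleton mesh pattern ($d$-SMP) $P$ is a set of $d$-tuples in $\{+,-\}^d$. For $i\ne j$, $\mathrm{sign}(\Pi_j-\Pi_i)\in\{+,-\}^d$ denotes the tuple of componentwise signs. The element $\Pi_i$ is an occurrence of $P$ in $\Pi$ if there is no $j\neq i$ with $\mathrm{sign}(\Pi_j-\Pi_i)\in P$. For $C\in\{+,-\}^d$, the complement $c(C)$ is obtained by replacing each $+$ by $-$ and each $-$ by $+$. A $d$-SMP $P'$ is minus-antipodal if for every $C\in\{+,-\}^d$: $C\in P'$ if and only if $c(C)\notin P'$ (so $|P'|=2^{d-1}$). *)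

(* Defs.v *)
From mathcomp Require Import all_boot all_fingroup.

Set Implicit Arguments.
Unset Strict Implicit.
Unset Printing Implicit Defensive.

(** Sign vectors: [true] stands for [+] and [false] for [-]. *)
Definition signvec (d : nat) := {ffun 'I_d -> bool}.

Definition compl (d : nat) (C : signvec d) : signvec d := [ffun k => ~~ C k].

(** Positions and values are numbered from 0; only differences of values
    matter below. *)
Definition dperm (d n : nat) := (d.-1).-tuple {perm 'I_n}.

(** The list [1%g :: Pi] is (pi^1, pi^2, ..., pi^d) with pi^1 the identity; it
    has length [d] as soon as [0 < d], so the default value of [nth] is then
    never used. *)
Definition element (d n : nat) (Pi : dperm d n) (j : 'I_n)
    : {ffun 'I_d -> 'I_n} :=
  [ffun k : 'I_d => nth 1%g (1%g :: Pi) k j].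

(** The vector sign(Pi_j - Pi_i). For [i != j] no coordinate of the difference
    vanishes, so a coordinate that is not [+] is indeed [-]. *)
Definition sign_diff (d n : nat) (Pi : dperm d n) (j i : 'I_n) : signvec d :=
  [ffun k => element Pi i k < element Pi j k].

Definition SMP (d : nat) := {set signvec d}.

Definition occurrence (d n : nat) (P : SMP d) (Pi : dperm d n) (i : 'I_n)
    : bool :=
  ~~ [exists j : 'I_n, (j != i) && (sign_diff Pi j i \in P)].

Definition minus_antipodal (d : nat) (P : SMP d) : Prop :=
  forall C : signvec d, C \in P <-> compl C \notin P.

(* Main.v *)
Require Import Defs.
From mathcomp Require Import all_boot all_fingroup.

(** Two distinct elements of a permutation see each other in opposite
    directions: if [Pi_j] lies in direction [C] from [Pi_i], then [Pi_i] lies in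
    direction [compl C] from [Pi_j].  So everything is decided by antipodal
    pairs [{C, compl C}].  If [P] meets every such pair, then of two distinct
    elements at least one is excluded, and at most one occurrence is left
    ([at_most_one_occurrence]).  If [P] misses a pair, the permutation of length
    two whose elements differ exactly in these directions has two occurrences
    ([missed_pair_two_occurrences]).  Finally, meeting every antipodal pair is
    the same as containing a minus-antipodal pattern, which is a choice of one
    vector from each pair ([contains_minus_antipodalP]). *)

Definition meets_antipodal_pairs (d : nat) (P : SMP d) : Prop :=
  forall C : signvec d, (C \in P) || (compl C \in P).

Lemma complK (d : nat) : involutive (@compl d).
Proof. by move=> C; apply/ffunP=> k; rewrite !ffunE negbK. Qed.

(** For [d = 0] the only sign vector is its own complement, so no pattern is
    minus-antipodal; a coordinate is needed to choose within a pair.  The pattern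
    constructed here takes from each pair the vector in [P], and the one with
    [+] in the first coordinate when both are in [P]. *)
Lemma contains_minus_antipodalP (d : nat) (P : SMP d.+1) :
  meets_antipodal_pairs d.+1 P <->
  exists P' : SMP d.+1, minus_antipodal P' /\ P' \subset P.
Proof.
split=> [meetP | [P' [antiP' /subsetP sP'P]] C]; last first.
  case: (boolP (compl C \in P')) => [/sP'P-> | /antiP'/sP'P-> //].
  by rewrite orbT.
exists [set C in P | (compl C \notin P) || C ord0]; split; last first.
  by apply/subsetP=> C; rewrite inE => /andP[].
move=> C; rewrite !inE complK [compl C ord0]ffunE.
by case: (C \in P) (compl C \in P) (C ord0) (meetP C) => [] [] [].
Qed.

Lemma sign_diff_opp (d n : nat) (Pi : dperm d n) (i j : 'I_n) :
  i != j -> sign_diff Pi i j = compl (sign_diff Pi j i).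
Proof.
move=> neq_ij; apply/ffunP=> k; rewrite !ffunE -leqNgt [RHS]leq_eqVlt.
by rewrite (inj_eq (@ord_inj n)) (inj_eq perm_inj) eq_sym (negPf neq_ij).
Qed.

Lemma at_most_one_occurrence (d n : nat) (P : SMP d) (Pi : dperm d n) :
  meets_antipodal_pairs d P -> #|[set i : 'I_n | occurrence P Pi i]| <= 1.
Proof.
move=> meetP; apply/card_le1_eqP=> i j; rewrite !inE => occ_i occ_j.
apply/eqP/negPn/negP=> neq_ji.
have := meetP (sign_diff Pi j i).
rewrite -sign_diff_opp 1?eq_sym // => /orP[Pji | Pij].
  by move/existsP: occ_i; apply; exists j; rewrite neq_ji.
by move/existsP: occ_j; apply; exists i; rewrite eq_sym neq_ji.
Qed.

(** As [pi^1] is the identity, the second element always lies on the [+] side of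
    the first one in the first coordinate; every other coordinate is free, the
    identity of ['I_2] giving [+] and the transposition giving [-]. *)
Lemma exists_length2_direction (d : nat) (C : signvec d.+1) :
  C ord0 -> exists Pi : dperm d.+1 2, sign_diff Pi ord_max ord0 = C.
Proof.
move=> C0.
pose pi (k : 'I_d) : {perm 'I_2} :=
  if C (lift ord0 k) then 1%g else tperm ord0 ord_max.
exists (mktuple pi).
apply/ffunP=> k; rewrite !ffunE.
case: (unliftP ord0 k) => [j -> | -> /=]; last by rewrite !perm1 C0.
rewrite lift0 -[nth _ _ _]/(nth 1%g (mktuple pi) j) nth_mktuple /pi.
by case: (C _); rewrite ?perm1 // tpermL tpermR.
Qed.

Lemma missed_pair_two_occurrences (d : nat) (P : SMP d.+1) (C : signvec d.+1) :
  C \notin P -> compl C \notin P ->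
  exists Pi : dperm d.+1 2, #|[set i : 'I_2 | occurrence P Pi i]| = 2.
Proof.
(* A pair is symmetric, so [C] may be taken to be its vector with first
   coordinate [+], the one that [exists_length2_direction] realises. *)
wlog C0 : C / C ord0 => [wlogC notPC notPcC |].
  case C0: (C ord0); first exact: (wlogC C).
  by apply: (wlogC (compl C)); rewrite ?complK // ffunE C0.
move=> notPC notPcC; have [Pi dirPi] := exists_length2_direction _ C C0.
exists Pi; rewrite -[RHS](card_ord 2) -cardsT; congr #|pred_of_set _|.
apply/setP=> i; rewrite !inE; apply/existsP=> -[j /andP[neq_ji]].
have ord2 (k : 'I_2) : k = ord0 \/ k = ord_max.
  by case: k => [[|[|//]] lt_k2]; [left | right]; apply: val_inj.
case: (ord2 i) (ord2 j) neq_ji => -> [] -> // _.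
  by rewrite dirPi (negPf notPC).
by rewrite sign_diff_opp // dirPi (negPf notPcC).
Qed.

Theorem theorem13 (d : nat) (hd : 2 <= d) (P : SMP d) :
  (forall (n : nat) (Pi : dperm d n), 1 <= n ->
     #|[set i : 'I_n | occurrence P Pi i]| <= 1) <->
  (exists P' : SMP d, minus_antipodal P' /\ P' \subset P).
Proof.
case: d hd P => // d _ P.
split=> [le1 | /contains_minus_antipodalP meetP n Pi _]; last first.
  exact: at_most_one_occurrence.
apply/contains_minus_antipodalP=> C.
apply: contraT; rewrite negb_or => /andP[notPC notPcC].
have [Pi two] := missed_pair_two_occurrences _ _ _ notPC notPcC.
by have := le1 2 Pi isT; rewrite two.
Qed.
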